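(* If $R$ is a ring in which every element is a sum or a difference of two commuting idempotents, then $R$ is weakly tripotent. The converse is not true: there exists a weakly tripotent ring in which not every element is a sum or a difference of two commuting idempotents.
   Context: Rings are associative with identity. An element $x$ of a ring is tripotent if $x^3=x$. A ring $R$ is weakly tripotent if for every $x\in R$ at least one of the elements $x$ or $1+x$ is tripotent. ''Every element is a sum or a difference of two commuting idempotents'' means that for every $x\in R$ there exist idempotents $e,f\in R$ with $ef=fe$ such that $x=e+f$ or $x=e-f$. *)

(* Defs.v *)
From HB Require Import structures.
From mathcomp Require Import all_boot all_algebra.
Set Implicit Arguments.
Unset Strict Implicit.
Unset Printing Implicit Defensive.
Import GRing.Theory.
Local Open Scope ring_scope.

(* [pzRingType]: associative rings with identity, not necessarily commutative;
   the zero ring is allowed. *)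

Definition idempotent_elt (R : pzRingType) (x : R) : Prop := x ^+ 2 = x.

Definition tripotent (R : pzRingType) (x : R) : Prop := x ^+ 3 = x.

Definition weakly_tripotent (R : pzRingType) : Prop :=
  forall x : R, tripotent x \/ tripotent (1 + x).

Definition sum_or_diff_of_comm_idempotents (R : pzRingType) : Prop :=
  forall x : R, exists e f : R,
    [/\ idempotent_elt e, idempotent_elt f, e * f = f * e
      & x = e + f \/ x = e - f].

(* Main.v *)
(** If [x = e + f] then [x ^+ 2 = x + 2ef] and [x ^+ 3 = x + 6ef], while a
    difference [e - f] is always tripotent.  Decomposing [-2] gives [12 = 0].
    If neither [x] nor [- x] is a difference, write [x = e + f] and
    [- x = g + h]; comparing the two
    expressions of [x ^+ 2] and of [x ^+ 3] gives [6x = 12gh = 0], and then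
    [(1 + x) ^+ 3 - (1 + x) = 12ef + 6x = 0].
    For the converse, every odd element of Z/8 is tripotent, but 3 is neither a
    sum nor a difference of elements of {0, 1}. *)
Require Import Defs.
From HB Require Import structures.
From mathcomp Require Import all_boot all_algebra.
Import GRing.Theory.
Local Open Scope ring_scope.

Section CommutingIdempotents.
Variables (R : pzRingType) (e f : R).
Hypotheses (idem_e : idempotent_elt e) (idem_f : idempotent_elt f).
Hypothesis comm_ef : e * f = f * e.

Let ee : e * e = e. Proof. by rewrite -expr2. Qed.
Let ff : f * f = f. Proof. by rewrite -expr2. Qed.

Lemma sqr_add_comm_idempotents : (e + f) ^+ 2 = (e + f) + (e * f) *+ 2.
Proof.
by rewrite expr2 mulrDl !mulrDr ee ff -comm_ef [e * f + f]addrC addrACA mulr2n.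
Qed.

Lemma mul_add_comm_idempotents : (e + f) * (e * f) = (e * f) *+ 2.
Proof. by rewrite mulrDl mulrA ee comm_ef mulrA ff mulr2n. Qed.

(** Multiplication by [e + f] doubles [e * f], so the cube exceeds the square by 4ef. *)
Lemma cube_add_comm_idempotents : (e + f) ^+ 3 = (e + f) + (e * f) *+ 6.
Proof.
rewrite exprS sqr_add_comm_idempotents mulrDr -expr2.
rewrite sqr_add_comm_idempotents mulrnAr mul_add_comm_idempotents.
by rewrite -mulrnA -addrA -mulrnDr.
Qed.

(** The square is e + f - 2ef; since e - f annihilates ef, the cube reduces to (e - f)(e + f) = e -
    f. *)
Lemma tripotent_sub_comm_idempotents : tripotent (e - f).
Proof.
have sq : (e - f) ^+ 2 = e + f - (e * f) *+ 2.
  by rewrite expr2 mulrBl !mulrBr ee ff -comm_ef opprB addrACA -opprD mulr2n.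
have xp : (e - f) * (e * f) = 0.
  by rewrite mulrBl mulrA ee {2}comm_ef mulrA ff comm_ef subrr.
rewrite /tripotent exprS sq mulrBr mulrnAr xp mul0rn subr0.
by rewrite mulrDr !mulrBl ee ff comm_ef addrA subrK.
Qed.

End CommutingIdempotents.

Lemma tripotentN (R : pzRingType) (x : R) : tripotent (- x) -> tripotent x.
Proof. by rewrite /tripotent exprNn -signr_odd /= mulN1r => /oppr_inj. Qed.

Lemma cube_1D (R : pzRingType) (x : R) :
  (1 + x) ^+ 3 = 1 + x *+ 3 + x ^+ 2 *+ 3 + x ^+ 3.
Proof.
by rewrite addrC exprD1n !big_ord_recr big_ord0 /= add0r expr0 expr1.
Qed.

Lemma sum_or_diff_char12 (R : pzRingType) :
  sum_or_diff_of_comm_idempotents R -> 12%:R = 0 :> R.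
Proof.
(* Decomposing 2 would give nothing, as 2 = 1 + 1 in any ring. *)
move=> /(_ (- 2%:R)) [e [f [ide idf cef [def_x|def_x]]]].
  have := sqr_add_comm_idempotents _ _ _ ide idf cef.
  have := mul_add_comm_idempotents _ _ _ ide idf cef.
  rewrite -def_x sqrrN -natrX mulNr mulr_natl => /eqP.
  rewrite eq_sym -addr_eq0 -mulrnDr => /eqP p4 /eqP.
  rewrite addrC -subr_eq opprK -natrD => /eqP.
  (* Here 6 = 2ef while 4ef = 0, so doubling gives 12 = 0. *)
  by move/(congr1 (fun y => y *+ 2)); rewrite -!mulrnA p4.
have := tripotent_sub_comm_idempotents _ _ _ ide idf cef.
rewrite -def_x => /tripotentN.
rewrite /tripotent -natrX => /eqP; rewrite -subr_eq0 -natrB // => /eqP e6.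
by rewrite -[12%N]/(6 + 6)%N natrD e6 addr0.
Qed.

Lemma sum_or_diff_weakly_tripotent (R : pzRingType) :
  sum_or_diff_of_comm_idempotents R -> weakly_tripotent R.
Proof.
move=> sdR x; have R12 := sum_or_diff_char12 _ sdR.
have n12 (y : R) : y *+ 12 = 0 by rewrite -mulr_natr R12 mulr0.
have [e [f [ide idf cef [def_x|->]]]] := sdR x; last first.
  by left; apply: tripotent_sub_comm_idempotents.
have [g [h [idg idh cgh [def_nx|def_nx]]]] := sdR (- x); last first.
  left; apply: tripotentN; rewrite def_nx.
  exact: tripotent_sub_comm_idempotents.
right.
have x2 : x ^+ 2 = x + (e * f) *+ 2 by rewrite def_x sqr_add_comm_idempotents.
have x3 : x ^+ 3 = x + (e * f) *+ 6 by rewrite def_x cube_add_comm_idempotents.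
have y2 : x ^+ 2 = - x + (g * h) *+ 2.
  by rewrite -sqrrN def_nx sqr_add_comm_idempotents.
have y3 : - x ^+ 3 = - x + (g * h) *+ 6.
  rewrite def_nx -cube_add_comm_idempotents // -def_nx.
  by rewrite exprNn -signr_odd mulN1r.
have efgh : (e * f) *+ 6 = - ((g * h) *+ 6).
  by move: y3; rewrite x3 opprD => /addrI <-; rewrite opprK.
have x6 : x *+ 6 = 0.
  (* Tripling x + 2ef = -x + 2gh and adding 3x gives 6x + 6ef = 6gh, where 6ef = -6gh. *)
  have /(congr1 (fun y => y *+ 3 + x *+ 3)) := etrans (esym x2) y2.
  rewrite /= !mulrnDl -!mulrnDr efgh mulNrn addrAC -mulrnDr.
  rewrite [RHS]addrAC addNr add0r => /eqP.
  by rewrite subr_eq -mulrnDr n12 => /eqP.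
(* The expansion of the cube becomes 1 + x + 6x + 12ef. *)
rewrite /tripotent cube_1D x2 x3 mulrnDl -mulrnA.
rewrite -2!addrA; congr (_ + _).
rewrite addrA (addrA (x *+ 3) (x *+ 3)) -(mulrnDr x 3 3) x6 add0r.
by rewrite addrCA -mulrnDr n12 addr0.
Qed.

Lemma weakly_tripotent_Z8 : weakly_tripotent 'Z_8.
Proof.
move=> x; suff /orP[] : (x ^+ 3 == x) || ((1 + x) ^+ 3 == 1 + x).
- by move/eqP; left.
- by move/eqP; right.
(* Each of the eight residues is settled by computation; any larger value violates the ordinal
   bound. *)
by case: x; do 8?[case=> [//|]].
Qed.

Lemma idempotent_Z8 (e : 'Z_8) : idempotent_elt e -> e = 0 \/ e = 1.
Proof.
move/eqP=> ide; suff /orP[] : (e == 0) || (e == 1).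
- by move/eqP; left.
- by move/eqP; right.
by move: ide; case: e; do 8?[case=> [//|]].
Qed.

Lemma not_sum_or_diff_Z8 : ~ sum_or_diff_of_comm_idempotents 'Z_8.
Proof.
move=> /(_ 3%:R) [e [f [/idempotent_Z8 e01 /idempotent_Z8 f01 _]]].
(* The only candidates are 0, 1, 2 and -1 = 7. *)
by case: e01 f01 => -> [] -> [] /eqP.
Qed.

Theorem corollary19 :
  (forall R : pzRingType,
     sum_or_diff_of_comm_idempotents R -> weakly_tripotent R) /\
  (exists R : pzRingType,
     weakly_tripotent R /\ ~ sum_or_diff_of_comm_idempotents R).
Proof.
split; first exact: sum_or_diff_weakly_tripotent.
by exists 'Z_8; split; [exact: weakly_tripotent_Z8|exact: not_sum_or_diff_Z8].
Qed.
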